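(* There exists a universal constant $A>0$ such that for any probability measure $\mu$ on $\mathbb{R}$ with finite moments, any bounded function $f:\mathbb{R}\to\mathbb{R}$, and any $\varepsilon>0$, $$P\left( \left|\frac{1}{n} X_f^{(n)}-\frac{1}{n}\mathbb{E} X_f^{(n)} \right|\geq \varepsilon \right)\leq 2 \exp \left(- n \varepsilon \min\left( \frac{ \varepsilon}{ 8A \|f\|_\infty^2}, \frac{1}{6 \|f \|_\infty} \right) \right)$$ for all $n \in \mathbb{N}$, where $X_f^{(n)}$ is the linear statistic of the orthogonal polynomial ensemble of size $n$ associated with $\mu$. In particular, if $(\mu_n)_{n\ge 1}$ is a sequence of such measures for which $\frac{1}{n}K_n(x,x)\,d\mu_n(x)$ (with $K_n$ the $n$-th Christoffel-Darboux kernel of $\mu_n$) has a weak limit $\nu$ as $n\to\infty$, and $f$ is bounded and continuous, then $$\lim_{n\to \infty} \frac{1}{n} X_f^{(n)}= \int f(x) \, d\nu(x)$$ almost surely, where $X_f^{(n)}$ is now the linear statistic of the orthogonal polynomial ensemble of size $n$ associated with $\mu_n$.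
   Context: Let $\mu$ be a probability measure on $\mathbb{R}$ with finite moments (and infinite support, so that all orthonormal polynomials exist). Let $p_j(x)=\gamma_j x^j+\dots$, $\gamma_j>0$, $j\ge 0$, be the orthonormal polynomials: $\int p_ip_j\,d\mu=\delta_{ij}$. The Christoffel-Darboux kernel is $K_n(x,y)=\sum_{j=0}^{n-1}p_j(x)p_j(y)$. The orthogonal polynomial ensemble (OPE) of size $n$ associated with $\mu$ is the probability measure on $\mathbb{R}^n$ $$\frac{1}{Z_n}\prod_{i>j}(\lambda_i-\lambda_j)^2\,d\mu(\lambda_1)\cdots d\mu(\lambda_n),$$ with $Z_n$ a normalizing constant. For $f:\mathbb{R}\to\mathbb{R}$ (Borel measurable), $X_f^{(n)}=\sum_{j=1}^n f(\lambda_j)$ with $(\lambda_1,\dots,\lambda_n)$ random from the OPE; $P$ and $\mathbb{E}$ refer to this measure. Weak convergence is tested against bounded continuous functions. For the almost sure statement, the random points for the different $n$ are realized on a common probability space (with an arbitrary coupling). $\|f\|_\infty$ is the supremum norm; when $f=0$ read $1/0=+\infty$. *)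

(* Defs.v *)
From HB Require Import structures.
From mathcomp Require Import all_boot all_order all_algebra.
From mathcomp Require Import all_classical all_reals all_analysis.
From mathcomp Require Import measurable_realfun.

Set Implicit Arguments.
Unset Strict Implicit.
Unset Printing Implicit Defensive.
Import Order.TTheory GRing.Theory Num.Theory.
Import numFieldNormedType.Exports.
Local Open Scope classical_set_scope.
Local Open Scope ring_scope.

(* The measure [w dmu]. The proofs [mw] and [w0] are arguments so that the
   measure structure can be inferred. *)
Definition mdensity d (T : measurableType d) (R : realType)
    (mu : {measure set T -> \bar R}) (w : T -> R)
    (mw : measurable_fun [set: T] w) (w0 : forall x, 0 <= w x) :=
  fun A : set T => (\int[mu]_(x in A) (w x)%:E)%E.

Section density.
Context d (T : measurableType d) (R : realType).
Variables (mu : {measure set T -> \bar R}) (w : T -> R).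
Variables (mw : measurable_fun [set: T] w) (w0 : forall x, 0 <= w x).

Let mdensity0 : mdensity mu mw w0 set0 = 0%E.
Proof. by rewrite /mdensity integral_set0. Qed.

Let mdensity_ge0 A : (0 <= mdensity mu mw w0 A)%E.
Proof. by apply: integral_ge0 => x _; rewrite lee_fin. Qed.

Let mdensity_sigma_additive : semi_sigma_additive (mdensity mu mw w0).
Proof.
apply: semi_sigma_additive_nng_induced; first exact/measurable_EFinP.
by move=> x; rewrite lee_fin.
Qed.

HB.instance Definition _ := isMeasure.Build _ _ _ (mdensity mu mw w0)
  mdensity0 mdensity_ge0 mdensity_sigma_additive.

End density.

Section power.
Context d (T : measurableType d) (R : realType).

Definition cons_pair n (x : T * n.-tuple T) : n.+1.-tuple T :=
  [tuple of x.1 :: x.2].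

Lemma measurable_cons_pair n :
  measurable_fun [set: T * n.-tuple T] (@cons_pair n).
Proof. exact: (measurable_cons measurable_fst measurable_snd). Qed.

HB.instance Definition _ n := isMeasurableFun.Build _ _ _ _ (@cons_pair n)
  (@measurable_cons_pair n).

(* The product of [n] copies of [mu], see [mpowerE]. *)
Fixpoint mpower (mu : probability T R) n : probability (n.-tuple T) R :=
  if n is n'.+1 then
    distribution (mu \x mpower mu n')%E (@cons_pair n')
  else \d_[tuple].

Lemma mpowerE (mu : probability T R) n (A : 'I_n -> set T) :
  (forall i, measurable (A i)) ->
  mpower mu n [set l | forall i, A i (tnth l i)] = (\prod_(i < n) mu (A i))%E.
Proof.
elim: n A => [|n IHn] A mA /=.
  by rewrite big_ord0 diracE mem_set//= => -[].
rewrite big_ord_recl -IHn => [|i]; last exact: mA.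
rewrite /distribution /pushforward.
rewrite -[X in _ = X]product_measure1E//; last first.
  rewrite [X in measurable X](_ : _ =
      \bigcap_(i in [set: 'I_n]) ((@tnth n T ^~ i) @^-1` A (lift ord0 i))).
    apply: fin_bigcap_measurable => // i _.
    by rewrite -[X in measurable X]setTI; exact: measurable_tnth.
  by apply/seteqP; split => l /= lA i; [move=> _|]; exact: lA.
congr ((_ \x _)%E _); apply/seteqP; split => -[x l] /=.
  move=> lA; split; first by have := lA ord0.
  by move=> i; have := lA (lift ord0 i); rewrite tnthS.
by move=> [Ax lA] i; case: (unliftP ord0 i) => [j ->|->//]; rewrite tnthS.
Qed.

End power.

Section orthogonal_polynomials.
Context (R : realType).
Implicit Types (mu : probability (measurableTypeR R) R) (p : nat -> {poly R}).

Definition finite_moments mu :=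
  forall k : nat, mu.-integrable [set: R] (fun x : R => (x ^+ k)%:E).

Definition msupport mu : set R :=
  [set x | forall U : set R, open U -> U x -> (0 < mu U)%E].

Definition orthonormal_polynomials mu p :=
  [/\ forall j, size (p j) = j.+1,
      forall j, 0 < lead_coef (p j) &
      forall i j, (\int[mu]_x ((p i).[x] * (p j).[x])%:E)%E = (i == j)%:R%:E].

Definition CD_kernel p n (x y : R) : R := \sum_(j < n) (p j).[x] * (p j).[y].

Definition CD_density p n (x : R) : R := n%:R^-1 * CD_kernel p n x x.

Lemma measurable_CD_density p n :
  measurable_fun [set: measurableTypeR R] (CD_density p n).
Proof.
apply: measurable_funM => //; apply: measurable_sum => j.
by apply: measurable_funM; exact: measurable_poly.
Qed.

Lemma CD_density_ge0 p n x : 0 <= CD_density p n x.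
Proof.
apply: mulr_ge0; first by rewrite invr_ge0.
by apply: sumr_ge0 => j _; rewrite -expr2 sqr_ge0.
Qed.

Definition CD_measure mu p n : {measure set (measurableTypeR R) -> \bar R} :=
  mdensity mu (measurable_CD_density p n) (CD_density_ge0 p n).

End orthogonal_polynomials.

Section orthogonal_polynomial_ensemble.
Context (R : realType).
Implicit Types (mu : probability (measurableTypeR R) R) (f : R -> R).

Definition vandermonde_sqr n (l : n.-tuple (measurableTypeR R)) : R :=
  \prod_(i < n) \prod_(j < n | (j < i)%N) (tnth l i - tnth l j) ^+ 2.

Lemma measurable_vandermonde_sqr n :
  measurable_fun [set: n.-tuple (measurableTypeR R)] (@vandermonde_sqr n).
Proof.
apply: measurable_prod => i _.
rewrite [X in measurable_fun _ X](_ : _ = fun l =>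
    \prod_(j < n) if (j < i)%N then (tnth l i - tnth l j) ^+ 2 else 1); last first.
  by apply/funext => l; exact: big_mkcond.
apply: measurable_prod => j _; case: (j < i)%N => //.
apply: measurable_funX; apply: measurable_funB; exact: measurable_tnth.
Qed.

Lemma vandermonde_sqr_ge0 n (l : n.-tuple (measurableTypeR R)) :
  0 <= vandermonde_sqr l.
Proof. by do 2 apply: prodr_ge0 => ? _; rewrite sqr_ge0. Qed.

(* [mnormalize] divides by the total mass [Z_n]; its last argument is a default
   value, used only if [Z_n] is [0] or [+oo], which never happens when [mu] has
   finite moments and infinite support. *)
Definition OPE mu n : probability (n.-tuple (measurableTypeR R)) R :=
  mnormalize
    (mdensity (mpower mu n) (@measurable_vandermonde_sqr n)
       (@vandermonde_sqr_ge0 n))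
    (mpower mu n).

Definition linear_statistic f n (l : n.-tuple (measurableTypeR R)) : R :=
  \sum_(i < n) f (tnth l i).

Definition sup_norm f : R := sup [set `|f x| | x in [set: R]].

End orthogonal_polynomial_ensemble.

Definition weakly_converges (R : realType)
    (m : nat -> {measure set (measurableTypeR R) -> \bar R})
    (nu : {measure set (measurableTypeR R) -> \bar R}) :=
  forall g : R -> R, continuous g -> bounded_fun g ->
    (\int[m n]_x (g x)%:E)%E @[n --> \oo] --> (\int[nu]_x (g x)%:E)%E.

(* Main.v *)
(** For orthonormal polynomials [p_j], Andreief's identity gives
[E exp (t X_f) = \det (\int p_i p_j exp (t f) dmu)], an [n x n] determinant of a
positive definite matrix.  Hadamard's inequality bounds it by the product of the
diagonal entries [\int p_j^2 exp (t f) dmu], so that the Laplace transform of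
[X_f] is at most the one of a sum of [n] independent bounded variables with laws
[p_j^2 dmu].  Expanding [exp (t f)] to second order yields
[E exp (t (X_f - m)) <= exp (2 n t^2 |f|^2)] for [t |f| <= 1/2], where
[m = \sum_j \int f p_j^2 dmu]; letting [t] tend to [0] forces [E X_f = m], and
Chernoff's bound gives the inequality with [A = 1].  Since [m / n] is the integral
of [f] against [K_n(x, x) / n dmu], the almost sure limit follows from the
Borel-Cantelli lemma. *)
Require Import Defs.
From HB Require Import structures.
From mathcomp Require Import all_boot all_order fingroup perm all_algebra.
From mathcomp Require Import all_classical all_reals all_analysis.
From mathcomp Require Import measurable_realfun ring lra.

Set Implicit Arguments.
Unset Strict Implicit.
Unset Printing Implicit Defensive.
Import Order.TTheory GRing.Theory Num.Theory.
Import numFieldNormedType.Exports.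
Local Open Scope classical_set_scope.
Local Open Scope ring_scope.

(** * Elementary bounds on the exponential *)

Lemma expR_le_invB1 (R : realType) (x : R) : x < 1 -> expR x <= (1 - x)^-1.
Proof.
move=> x1; have xp : 0 < 1 - x by rewrite subr_gt0.
rewrite -[x in expR x]opprK expRN lef_pV2 ?posrE ?expR_gt0//.
exact: expR_ge1Dx.
Qed.

(** From [expR x <= 1 / (1 - x)] and [(1 - x) (1 + x + 2 x^2) = 1 + x^2 (1 - 2 x)], which is at
    least 1 for [x <= 1/2]. *)
Lemma expR_le_quadratic (R : realType) (x : R) :
  `|x| <= 2^-1 -> expR x <= 1 + x + 2 * x ^+ 2.
Proof.
rewrite ler_norml => /andP[x1 x2].
have x_lt1 : x < 1 by lra.
apply: (le_trans (expR_le_invB1 x_lt1)).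
rewrite invf_ple ?posrE; last 2 first.
- by lra.
- by nra.
rewrite -div1r ler_pdivrMr; last by nra.
have : 0 <= x ^+ 2 * (1 - 2 * x) by rewrite mulr_ge0 ?sqr_ge0//; lra.
lra.
Qed.

(** * Determinants: Hadamard's inequality and the Vandermonde factorization *)

(* Schur complement: eliminating the first variable leaves a positive definite
   form whose diagonal has not increased. *)
Lemma det_le_prod_diag (R : realFieldType) n (G : 'M[R]_n) : G^T = G ->
    (forall v : 'rV_n, v != 0 -> 0 < (v *m G *m v^T) 0 0) ->
  \det G <= \prod_(i < n) G i i.
Proof.
elim: n G => [|n IHn] G symG posG; first by rewrite det_mx00 big_ord0.
pose a := G ord0 ord0.
have a_gt0 : 0 < a.
  have := posG (delta_mx 0 ord0); rewrite trmx_delta -rowE -colE !mxE.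
  by apply; apply/eqP => /matrixP/(_ 0 ord0)/eqP; rewrite !mxE !eqxx oner_eq0.
pose b : 'rV_n := @ursubmx R 1 n 1 n G.
pose D : 'M[R]_n := @drsubmx R 1 n 1 n G.
have GE : G = block_mx a%:M b b^T D :> 'M[R]_(1 + n).
  rewrite -[LHS](@submxK R 1 n 1 n); congr block_mx.
    by rewrite [LHS]mx11_scalar !mxE; congr (G _ _)%:M; exact/val_inj.
  by rewrite -[in LHS]symG; apply/matrixP => i j; rewrite !mxE.
pose S := D - a^-1 *: (b^T *m b).
have detG : \det G = a * \det S.
  (* Block elimination: [L] has determinant 1 and clears the column below the pivot [a]. *)
  pose L : 'M[R]_(1 + n) := block_mx 1%:M 0 (- a^-1 *: b^T) 1%:M.
  have : \det (L *m (G : 'M[R]_(1 + n))) = \det (block_mx a%:M b 0 S).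
    congr (\det _); rewrite GE mulmx_block !mul1mx !mul0mx !addr0.
    congr block_mx.
    - rewrite -scalemxAl mul_mx_scalar scalerA mulNr mulVf ?gt_eqF// scaleN1r.
      by rewrite addNr.
    - by rewrite -scalemxAl scaleNr addrC.
  by rewrite det_mulmx det_lblock !det1 !mul1r det_ublock det_scalar1.
have posS (v : 'rV_n) : v != 0 -> 0 < (v *m S *m v^T) 0 0.
  move=> v0; pose c := (v *m b^T) 0 0.
  have vbE : v *m b^T = c%:M by rewrite [LHS]mx11_scalar.
  have bvE : b *m v^T = c%:M by rewrite -[LHS]trmxK trmx_mul trmxK vbE tr_scalar_mx.
  (* The first coordinate [- c / a] minimizes the form of [G] over the vectors ending in [v]; the
     minimum is the form of [S] at [v]. *)
  have w0 : row_mx (- (a^-1 * c))%:M v != 0 :> 'rV_(1 + n).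
    apply: contraNneq v0 => /(congr1 (@rsubmx _ _ 1 _)).
    by rewrite row_mxKr linear0 => ->.
  have posG' (w : 'rV[R]_(1 + n)) : w != 0 ->
      0 < (w *m block_mx a%:M b b^T D *m w^T) 0 0.
    by rewrite -GE; exact: posG.
  have := posG' _ w0.
  rewrite mul_row_block tr_row_mx mul_row_col vbE -scalar_mxM -raddfD/=.
  rewrite mulrC mulrN mulrA divff ?gt_eqF// mul1r addNr raddf0 mul0mx add0r.
  rewrite mul_scalar_mx mulmxDl -scalemxAl bvE /S mulmxBr mulmxBl.
  rewrite -scalemxAr -scalemxAl mulmxA vbE mul_scalar_mx -scalemxAl bvE.
  by rewrite !mxE/= !mulr1n mulNr mulrA addrC.
have symS : S^T = S.
  rewrite /S linearB linearZ/= trmx_mul trmxK; congr (_ - _).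
  by apply/matrixP => i j; rewrite !mxE -[in LHS]symG mxE.
have SE i : S i i = G (lift ord0 i) (lift ord0 i) - a^-1 * b 0 i ^+ 2.
  rewrite !mxE big_ord1 !mxE; congr (G _ _ - _); exact/val_inj.
have S_gt0 i : 0 < S i i.
  have := posS (delta_mx 0 i); rewrite trmx_delta -rowE -colE !mxE.
  by apply; apply/eqP => /matrixP/(_ 0 i)/eqP; rewrite !mxE !eqxx oner_eq0.
rewrite detG big_ord_recl ler_pM2l//; apply: (le_trans (IHn _ symS posS)).
apply: ler_prod => i _; rewrite ltW//= SE gerBl mulr_ge0 ?sqr_ge0//.
by rewrite invr_ge0 ltW.
Qed.

(* Row operations: the matrix factors through the Vandermonde matrix, with the
   triangular matrix of the coefficients of the [p i]. *)
Lemma det_horner_sqr (R : realType) n (p : nat -> {poly R})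
    (l : n.-tuple (measurableTypeR R)) :
  (forall j, (j < n)%N -> size (p j) = j.+1) ->
  (\det (\matrix_(i < n, j < n) (p i).[tnth l j])) ^+ 2 =
  (\prod_(i < n) lead_coef (p i)) ^+ 2 * vandermonde_sqr l.
Proof.
move=> sp; pose C : 'M[R]_n := \matrix_(i, j) (p i)`_j.
pose v : 'rV[R]_n := \row_j tnth l j.
have -> : \matrix_(i < n, j < n) (p i).[tnth l j] = C *m Vandermonde n v.
  apply/matrixP => i j; rewrite !mxE.
  rewrite (@horner_coef_wide _ n) ?sp//.
  by apply: eq_bigr => k _; rewrite !mxE.
rewrite det_mulmx exprMn; congr (_ ^+ 2 * _).
  rewrite det_trig; last first.
    apply/is_trig_mxP => i j ij; rewrite !mxE nth_default// sp//.
  by apply: eq_bigr => i _; rewrite mxE lead_coefE sp.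
rewrite det_Vandermonde -prodrXl /vandermonde_sqr.
under eq_bigr do rewrite -prodrXl.
(* [det_Vandermonde] lists the pairs by their smaller index, [vandermonde_sqr] by the larger one. *)
rewrite (exchange_big_dep xpredT)//=; apply: eq_bigr => i _.
by apply: eq_bigr => j _; rewrite !mxE.
Qed.

(** * Integration against a density *)

Section density_integral.
Local Open Scope ereal_scope.
Context d (T : measurableType d) (R : realType).
Variables (mu : {measure set T -> \bar R}) (w : T -> R).
Variables (mw : measurable_fun [set: T] w) (w0 : forall x, (0 <= w x)%R).

Import HBNNSimple.

(** By definition of [mdensity] for indicators, then by linearity for simple functions, and by
    monotone convergence along [nnsfun_approx] in general. *)
Lemma ge0_integral_mdensity (f : T -> \bar R) :
    measurable_fun [set: T] f -> (forall x, 0 <= f x) ->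
  \int[mdensity mu mw w0]_x f x = \int[mu]_x (f x * (w x)%:E).
Proof.
move=> mf f0; pose h := nnsfun_approx measurableT mf.
have mEw : measurable_fun [set: T] (EFin \o w) by exact/measurable_EFinP.
have hf x : (EFin \o h n) x @[n --> \oo] --> f x.
  exact: cvg_nnsfun_approx.
transitivity (limn (fun n => \int[mdensity mu mw w0]_x (h n x)%:E)).
  rewrite -monotone_convergence//=.
  - by apply: eq_integral => x _; apply/esym/cvg_lim => //; exact: hf.
  - by move=> n; exact/measurable_EFinP.
  - by move=> n x _; rewrite lee_fin.
  - by move=> x _ m n mn; rewrite lee_fin; exact/lefP/nd_nnsfun_approx.
transitivity (limn (fun n => \int[mu]_x ((h n x)%:E * (w x)%:E))); last first.
  rewrite -monotone_convergence//=.
  - apply: eq_integral => x _; apply/cvg_lim => //.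
    by apply: cvgeZr => //; exact: hf.
  - by move=> n; apply: emeasurable_funM => //; exact/measurable_EFinP.
  - by move=> n x _; rewrite mule_ge0 ?lee_fin.
  - move=> x _ m n mn; rewrite lee_wpmul2r ?lee_fin//.
    exact/lefP/nd_nnsfun_approx.
congr (limn _); apply/funext => n.
have mhr r : measurable_fun [set: T] (fun x => \1_(h n @^-1` [set r]) x : R).
  exact/measurable_indicP.
have h0 r x : 0 <= (r * \1_(h n @^-1` [set r]) x)%:E.
  by rewrite EFinM nnfun_muleindic_ge0.
transitivity (\sum_(r \in range (h n))
    \int[mdensity mu mw w0]_x (r * \1_(h n @^-1` [set r]) x)%:E).
  rewrite -ge0_integral_fsum//; last first.
    by move=> r; exact/measurable_EFinP/measurable_funM.
  by apply: eq_integral => x _; rewrite fsumEFin// -fimfunE.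
transitivity (\sum_(r \in range (h n))
    \int[mu]_x ((r * \1_(h n @^-1` [set r]) x)%:E * (w x)%:E)); last first.
  rewrite -ge0_integral_fsum//; last 2 first.
  - move=> r; apply: emeasurable_funM => //.
    exact/measurable_EFinP/measurable_funM.
  - by move=> r x _; rewrite mule_ge0// lee_fin.
  apply: eq_integral => x _; rewrite -ge0_mule_fsuml//.
  by rewrite fsumEFin// -fimfunE.
apply: eq_fsbigr => _ /[!inE] -[y _ <-].
rewrite integralZl_indic_nnsfun// integral_indic// setIT.
under [RHS]eq_integral do rewrite EFinM -muleA.
rewrite ge0_integralZl_EFin//=; last 2 first.
- by move=> x _; rewrite mule_ge0 ?lee_fin.
- by apply: emeasurable_funM => //; exact/measurable_EFinP.
congr (_ * _); rewrite /mdensity integral_mkcond.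
by apply: eq_integral => x _; rewrite epatch_indic/= muleC.
Qed.

Lemma integral_mdensity (f : T -> \bar R) : measurable_fun [set: T] f ->
  \int[mdensity mu mw w0]_x f x = \int[mu]_x (f x * (w x)%:E).
Proof.
move=> mf; rewrite [LHS]integralE [RHS]integralE; congr (_ - _).
  rewrite ge0_integral_mdensity//; last exact: measurable_funepos.
  by apply: eq_integral => x _; rewrite !funeposE muleC maxe_pMr ?lee_fin// mule0 muleC.
rewrite ge0_integral_mdensity//; last exact: measurable_funeneg.
by apply: eq_integral => x _; rewrite !funenegE muleC maxe_pMr ?lee_fin// mule0 muleN muleC.
Qed.

End density_integral.

(** * Product measures and Andreief's identity *)

Section product_integral.
Context d (T : measurableType d) (R : realType) (mu : probability T R).

Lemma measurable_prod_tnth n (h : 'I_n -> T -> R) :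
    (forall i, measurable_fun [set: T] (h i)) ->
  measurable_fun [set: n.-tuple T] (fun l => \prod_(i < n) h i (tnth l i)).
Proof.
move=> mh; apply: measurable_prod => i _.
by apply: measurableT_comp => //; exact: measurable_tnth.
Qed.

(** Induction on [n] with Fubini's theorem. Integrability and value are proved together, since the
    step needs the product over the remaining coordinates to be integrable. *)
Lemma Rintegral_mpower_prod n (h : 'I_n -> T -> R) :
    (forall i, mu.-integrable [set: T] (EFin \o h i)) ->
  (mpower mu n).-integrable [set: n.-tuple T]
      (fun l => (\prod_(i < n) h i (tnth l i))%:E) /\
  \int[mpower mu n]_l (\prod_(i < n) h i (tnth l i)) =
  \prod_(i < n) \int[mu]_x h i x.
Proof.
elim: n h => [|n IHn] h ih.
  under [X in integrable _ _ X]eq_fun do rewrite big_ord0.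
  split; first exact: finite_measure_integrable_cst.
  under eq_Rintegral do rewrite big_ord0.
  rewrite Rintegral_cst// big_ord0 mul1r.
  by rewrite [X in fine X](_ : _ = 1%E)//; exact: probability_setT.
have mh i : measurable_fun [set: T] (h i).
  by apply/measurable_EFinP; exact: measurable_int (ih i).
have mprod : measurable_fun [set: n.+1.-tuple T]
    (fun l => (\prod_(i < n.+1) h i (tnth l i))%:E).
  apply/measurable_EFinP; exact: measurable_prod_tnth.
have [ih' IH] := IHn (fun i => h (lift ord0 i)) (fun i => ih _).
set h' := fun l : n.-tuple T => \prod_(i < n) h (lift ord0 i) (tnth l i) in ih' IH.
have prodE x : \prod_(i < n.+1) h i (tnth (cons_pair x) i) = h ord0 x.1 * h' x.2.
  by rewrite big_ord_recl; congr (_ * _); apply: eq_bigr => i _; rewrite tnthS.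
have mh' : measurable_fun [set: n.-tuple T] h'.
  by apply/measurable_EFinP; exact: measurable_int ih'.
have mF : measurable_fun [set: T * n.-tuple T]
    (fun x => (h ord0 x.1 * h' x.2)%:E).
  apply/measurable_EFinP/measurable_funM.
  - exact: measurableT_comp.
  - exact: measurableT_comp.
have iF : (mu \x mpower mu n)%E.-integrable [set: T * n.-tuple T]
    (fun x => (h ord0 x.1 * h' x.2)%:E).
  (* Tonelli: the iterated integral of the absolute value is a product of two finite integrals. *)
  apply/integrable12ltyP => //=.
  have intE x : (\int[mpower mu n]_l `|(h ord0 x * h' l)%:E| =
      `|h ord0 x|%:E * \int[mpower mu n]_l `|h' l|%:E)%E.
    under eq_integral do rewrite /= normrM EFinM.
    rewrite ge0_integralZl_EFin//=.
    by apply/measurable_EFinP; exact: measurableT_comp.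
  under eq_integral do rewrite intE.
  have /fineK <- : (\int[mpower mu n]_l `|h' l|%:E)%E \is a fin_num.
    exact: integrable_fin_num (integrable_norm ih').
  rewrite ge0_integralZr//=.
  - apply: lte_mul_pinfty.
    + by apply: integral_ge0 => x _; rewrite lee_fin.
    + exact: integrable_fin_num (integrable_norm (ih ord0)).
    + by rewrite ltry.
  - by apply/measurable_EFinP; exact: measurableT_comp.
  - by rewrite lee_fin fine_ge0//; apply: integral_ge0 => x _; rewrite lee_fin.
have iFc : (mu \x mpower mu n)%E.-integrable (@cons_pair _ T n @^-1` setT)
    ((fun l => (\prod_(i < n.+1) h i (tnth l i))%:E) \o @cons_pair _ T n).
  rewrite preimage_setT; apply: eq_integrable iF => // x _ /=.
  by rewrite prodE.
split; first by apply: integrable_pushforward.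
rewrite /Rintegral [X in fine X](@integral_pushforward _ _ _ _ _ (@cons_pair _ T n))//.
rewrite preimage_setT.
under eq_integral do rewrite /= prodE.
rewrite -integral12_prod_meas1//= /fubini_F/=.
have intE x : (\int[mpower mu n]_l (h ord0 x * h' l)%:E =
    (h ord0 x)%:E * \int[mpower mu n]_l (h' l)%:E)%E.
  by under eq_integral do rewrite EFinM; rewrite integralZl.
under eq_integral do rewrite intE.
rewrite big_ord_recl -IH /Rintegral.
have /fineK <- : (\int[mpower mu n]_l (h' l)%:E)%E \is a fin_num.
  exact: integrable_fin_num.
rewrite integralZr//; last exact: ih.
by rewrite fineM//; exact: integrable_fin_num (ih ord0).
Qed.

End product_integral.

Section finite_sum_integral.
Context d (T : measurableType d) (R : realType).

Lemma integrable_Rsum (mu : {measure set T -> \bar R}) I (s : seq I)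
    (f : I -> T -> R) : (forall i, mu.-integrable [set: T] (EFin \o f i)) ->
  mu.-integrable [set: T] (fun x => (\sum_(i <- s) f i x)%:E).
Proof.
move=> fi; under eq_fun do rewrite -sumEFin.
by apply: integrable_sum => // i _; exact: fi.
Qed.

Lemma Rintegral_sum (mu : {measure set T -> \bar R}) I (s : seq I)
    (f : I -> T -> R) : (forall i, mu.-integrable [set: T] (EFin \o f i)) ->
  \int[mu]_x (\sum_(i <- s) f i x) = \sum_(i <- s) \int[mu]_x f i x.
Proof.
move=> fi; elim: s => [|i s IHs].
  by under eq_Rintegral do rewrite big_nil; rewrite Rintegral_cst// mul0r big_nil.
under eq_Rintegral do rewrite big_cons.
by rewrite RintegralD// ?IHs ?big_cons//; exact: integrable_Rsum.
Qed.

End finite_sum_integral.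

(** Both determinants are expanded over permutations [s] and [t], and each term integrates to a
    product of one-variable integrals. Once [t] is replaced by [s * t], the sum over [t] is the same
    determinant for every [s]; hence the factorial. *)
Lemma andreief d (T : measurableType d) (R : realType) (mu : probability T R) n
    (phi psi : 'I_n -> T -> R) :
    (forall i j, mu.-integrable [set: T] (fun x => (phi i x * psi j x)%:E)) ->
  (mpower mu n).-integrable [set: n.-tuple T] (fun l =>
    (\det (\matrix_(i, j) phi i (tnth l j)) *
     \det (\matrix_(i, j) psi i (tnth l j)))%:E) /\
  \int[mpower mu n]_l (\det (\matrix_(i, j) phi i (tnth l j)) *
                       \det (\matrix_(i, j) psi i (tnth l j))) =
  n`!%:R * \det (\matrix_(i, j) \int[mu]_x (phi i x * psi j x)).
Proof.
move=> int_phipsi.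
pose h (s t : 'S_n) (i : 'I_n) x := phi (s i) x * psi (t i) x.
have H s t := @Rintegral_mpower_prod _ _ _ mu n (h s t) (fun i => int_phipsi _ _).
have detE l : \det (\matrix_(i, j) phi i (tnth l j)) *
     \det (\matrix_(i, j) psi i (tnth l j)) = \sum_(s : 'S_n) \sum_(t : 'S_n)
     ((-1) ^+ s * (-1) ^+ t) * \prod_(i < n) h s t i (tnth l i).
  rewrite -det_tr -[X in _ * X]det_tr big_distrl/=; apply: eq_bigr => s _.
  rewrite big_distrr/=; apply: eq_bigr => t _.
  rewrite mulrACA; congr (_ * _); rewrite -big_split/=.
  by apply: eq_bigr => i _; rewrite !mxE.
have int_h (s t : 'S_n) : (mpower mu n).-integrable [set: n.-tuple T]
    (EFin \o (fun l => ((-1) ^+ s * (-1) ^+ t) *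
                       \prod_(i < n) h s t i (tnth l i))).
  by apply: (integrableZl _ _ (H s t).1).
split.
  under eq_fun do rewrite detE.
  by do 2 apply: integrable_Rsum => ?.
under eq_Rintegral do rewrite detE.
rewrite Rintegral_sum => [|s]; last exact: integrable_Rsum.
have -> : n`!%:R = \sum_(s : 'S_n) (1 : R).
  by rewrite sumr_const card_Sn.
rewrite big_distrl/=; apply: eq_bigr => s _; rewrite mul1r.
rewrite Rintegral_sum => [|t]; last exact: int_h.
rewrite (reindex_inj (mulgI s))/=; apply: eq_bigr => t _.
rewrite RintegralZl ?(H _ _).1// (H _ _).2.
rewrite odd_permM signr_addb mulrA -expr2 sqrr_sign mul1r; congr (_ * _).
(* In [s * t] the permutation [s] acts first, so running over [s i] instead of [i] matches the
   factors. *)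
rewrite [RHS](reindex_inj (@perm_inj _ s))/=.
apply: eq_bigr => i _; rewrite mxE.
by apply: eq_Rintegral => x _; rewrite /h permM.
Qed.

(** * Existence of orthonormal polynomials *)

Section orthonormal.
Context (R : realType) (mu : probability (measurableTypeR R) R).
Hypothesis mu_moments : finite_moments mu.

Lemma integrable_horner (q : {poly R}) :
  mu.-integrable [set: measurableTypeR R] (fun x => (q.[x])%:E).
Proof.
under eq_fun do rewrite horner_coef.
apply: integrable_Rsum => i; exact: (integrableZl _ _ (mu_moments i)).
Qed.

Lemma integrable_bounded_horner (g : measurableTypeR R -> R) C (q : {poly R}) :
    measurable_fun [set: measurableTypeR R] g -> (forall x, `|g x| <= C) ->
  mu.-integrable [set: measurableTypeR R] (fun x => (g x * q.[x])%:E).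
Proof.
move=> mg gC; under eq_fun do rewrite EFinM.
apply: (@integrableMr _ _ _ _ _ measurableT g (fun x => (q.[x])%:E)) => //.
  exists C; split; first exact: num_real.
  by move=> M /ltW CM x _; exact: le_trans (gC x) CM.
exact: integrable_horner.
Qed.

(** Truncation of [orthonormal_polynomials] to the indices below [n], which are those that the
    ensemble of size [n] involves. Finite Gram-Schmidt families and full orthonormal sequences both
    satisfy it. *)
Definition orthonormal_upto (p : nat -> {poly R}) n :=
  [/\ forall j, (j < n)%N -> size (p j) = j.+1,
      forall j, (j < n)%N -> 0 < lead_coef (p j) &
      forall i j, (i < n)%N -> (j < n)%N ->
        \int[mu]_x ((p i).[x] * (p j).[x]) = (i == j)%:R].

Hypothesis mu_support : infinite_set (msupport mu).

(** A nonzero polynomial has finitely many roots, so it is nonzero at some point of the infinite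
    support, and the open set where it is nonzero has positive measure. A zero integral would make
    that set negligible. *)
Lemma Rintegral_sqr_horner_gt0 (q : {poly R}) : q != 0 ->
  0 < \int[mu]_x (q.[x] * q.[x]).
Proof.
move=> q0.
have [x0 [x0mu qx0]] : exists x, msupport mu x /\ q.[x] != 0.
  apply/not_existsP => noroot.
  (* [B] contains at least [size q] points of the support, more than [q] can have roots. *)
  have [B Bmu sB] := infinite_set_fset (size q) mu_support.
  have := max_poly_roots q0 (rs := finmap.enum_fset B).
  rewrite ltnNge sB => /(_ _ (finmap.fset_uniq _)) H.
  suff /H : all (root q) (finmap.enum_fset B) by [].
  apply/allP => x xB; apply/negPn/negP => qx; apply: (noroot x); split => //.
  exact: Bmu.
pose U : set R := [set x | q.[x] != 0].
have Uo : open U.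
  apply: (@open_comp _ _ (horner q) [set y | y != 0]).
    by move=> x _; exact: continuous_horner.
  exact: open_neq.
have muU := x0mu _ Uo qx0.
have mqq : measurable_fun [set: measurableTypeR R] (fun x => (q.[x] * q.[x])%:E).
  by apply/measurable_EFinP/measurable_funM; exact: measurable_poly.
have qq_ge0 : (0 <= \int[mu]_x (q.[x] * q.[x])%:E)%E.
  by apply: integral_ge0 => x _; rewrite lee_fin -expr2 sqr_ge0.
apply: fine_gt0; apply/andP; split; last first.
  rewrite integrable_lty//; under eq_fun do rewrite -hornerM.
  exact: integrable_horner.
rewrite lt_neqAle qq_ge0 andbT; apply/negP => /eqP int0.
have /ae_eq_integral_abs : measurable_fun [set: measurableTypeR R]
  (fun x => (q.[x] * q.[x])%:E) by [].
move=> /(_ mu measurableT)[+ _].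
under eq_integral do rewrite /= ger0_norm -?expr2 ?sqr_ge0// expr2.
move=> /(_ (esym int0)) [N [mN N0 UN]].
have : (mu U <= mu N)%E.
  apply: le_measure; rewrite ?inE//; first exact: open_measurable.
  move=> x qx; apply: UN => /= /(_ I) [] /eqP; rewrite mulf_eq0 orbb.
  exact/negP.
by rewrite N0 leNgt muU.
Qed.

Lemma orthonormal_upto_exists n : exists p, orthonormal_upto p n.
Proof.
elim: n => [|n [p [sp lp op]]]; first by exists (fun=> 0); split.
pose J (q : {poly R}) := \int[mu]_x q.[x].
have JD q r : J (q + r) = J q + J r.
  by rewrite /J -RintegralD//; [under eq_Rintegral do rewrite hornerD|
    exact: integrable_horner|exact: integrable_horner].
have JZ c q : J (c *: q) = c * J q.
  by rewrite /J -RintegralZl//; [under eq_Rintegral do rewrite hornerZ|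
    exact: integrable_horner].
have JM q r : J (q * r) = \int[mu]_x (q.[x] * r.[x]).
  by apply: eq_Rintegral => x _; rewrite hornerM.
have J0 : J 0 = 0 by rewrite -(scale0r 0) JZ mul0r.
have Jsum I (s : seq I) (F : I -> {poly R}) :
    J (\sum_(i <- s) F i) = \sum_(i <- s) J (F i).
  by elim: s => [|i s IHs]; rewrite ?big_nil// !big_cons JD IHs.
(* Gram-Schmidt: [u] is the orthogonal projection of ['X^n] on the span of the previous polynomials.
   Its degree is below [n], so [q] is monic of degree [n]. *)
pose u := \sum_(j < n) J ('X^n * p j) *: p j.
pose q := 'X^n - u.
have su : (size u <= n)%N.
  apply: (leq_trans (size_sum _ _ _)); apply/bigmax_leqP => j _.
  by rewrite (leq_trans (size_scale_leq _ _))// sp.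
have sq : size q = n.+1.
  by rewrite size_polyDl size_polyXn// size_polyN.
have lq : lead_coef q = 1.
  by rewrite lead_coefDl ?lead_coefXn// size_polyN size_polyXn.
have q0 : q != 0 by rewrite -size_poly_eq0 sq.
have Jq (i : nat) : (i < n)%N -> J (q * p i) = 0.
  move=> i_n; rewrite mulrBl JD -scaleN1r JZ /u big_distrl/= Jsum.
  rewrite (bigD1 (Ordinal i_n))//= big1 => [|j ji].
    by rewrite -scalerAl JZ (JM (p i)) op// eqxx mulr1 addr0 mulN1r subrr.
  rewrite -scalerAl JZ (JM (p j)) op// [_ == _](_ : _ = false) ?mulr0//.
  by apply/negbTE; apply: contra ji => /eqP ji; exact/eqP/val_inj.
pose N := J (q * q).
have N_gt0 : 0 < N by rewrite /N JM Rintegral_sqr_horner_gt0.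
pose r := (Num.sqrt N)^-1.
have r_gt0 : 0 < r by rewrite invr_gt0 sqrtr_gt0.
exists (fun j => if j == n then r *: q else p j); split.
- move=> j; rewrite ltnS leq_eqVlt; case: eqVneq => [-> _|_ /= jn].
    by rewrite size_scale ?gt_eqF.
  exact: sp.
- move=> j; rewrite ltnS leq_eqVlt; case: eqVneq => [-> _|_ /= jn].
    by rewrite lead_coefZ lq mulr1.
  exact: lp.
- move=> i j; rewrite !ltnS (leq_eqVlt i) (leq_eqVlt j) -JM.
  case: (eqVneq i n) => [->|in'] /= i_n; case: (eqVneq j n) => [->|jn'] /= j_n.
  + rewrite -scalerAl -scalerAr !JZ -/N mulrA -expr2 exprVn sqr_sqrtr ?ltW//.
    by rewrite mulVf// gt_eqF.
  + by rewrite -scalerAl JZ Jq// mulr0.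
  + by rewrite -scalerAr JZ mulrC (mulrC (p i)) Jq// mul0r (negbTE in').
  + by rewrite JM op.
Qed.

End orthonormal.

(** * Heine's formula and the Gram matrix *)

Lemma ge0_integral_mnormalize d (T : measurableType d) (R : realType)
    (m : {measure set T -> \bar R}) (P : probability T R) (z : R)
    (f : T -> \bar R) :
    0 < z -> m [set: T] = z%:E -> measurable_fun [set: T] f ->
    (forall x, 0 <= f x)%E ->
  (\int[mnormalize m P]_x f x = z^-1%:E * \int[m]_x f x)%E.
Proof.
move=> z0 mz mf f0; have z1 : 0 <= z^-1 by rewrite invr_ge0 ltW.
rewrite -[z^-1]/((NngNum z1)%:num) -ge0_integral_mscale//.
apply: eq_measure_integral => A mA _.
(* The total mass [z] is neither 0 nor infinite, so [mnormalize] does not fall back on its default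
   [P]. *)
by rewrite /= /mnormalize mz eqe gt_eqF//= /mscale/= muleC.
Qed.

Section heine.
Context (R : realType) (mu : probability (measurableTypeR R) R).
Context (p : nat -> {poly R}) (n : nat).
Hypotheses (mu_moments : finite_moments mu) (op : orthonormal_upto mu p n).

(** The matrix, in the orthonormal basis, of multiplication by [g] compressed to the polynomials of
    degree below [n]. *)
Definition gram (g : measurableTypeR R -> R) : 'M[R]_n :=
  \matrix_(i, j) \int[mu]_x (g x * (p i).[x] * (p j).[x]).

Let gammas := (\prod_(i < n) lead_coef (p i)) ^+ 2.

Let gammas_gt0 : 0 < gammas.
Proof.
by rewrite exprn_gt0// prodr_gt0// => i _; case: op => _ lp _; exact: lp.
Qed.

(** Andreief's identity for the families [g * p i] and [p i]: the product of their determinants is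
    [gammas] times the integrand, by [det_horner_sqr]. *)
Lemma heine (g : measurableTypeR R -> R) C :
    measurable_fun [set: measurableTypeR R] g -> (forall x, `|g x| <= C) ->
  (mpower mu n).-integrable [set: n.-tuple (measurableTypeR R)]
    (fun l => ((\prod_(i < n) g (tnth l i)) * vandermonde_sqr l)%:E) /\
  \int[mpower mu n]_l ((\prod_(i < n) g (tnth l i)) * vandermonde_sqr l) =
  gammas^-1 * (n`!%:R * \det (gram g)).
Proof.
move=> mg gC.
have int_g (i j : 'I_n) : mu.-integrable [set: measurableTypeR R]
    (fun x => (g x * (p i).[x] * (p j).[x])%:E).
  under eq_fun do rewrite -mulrA -hornerM.
  exact: integrable_bounded_horner mg gC.
have [int_l intE] := andreief int_g.
have detE (l : n.-tuple (measurableTypeR R)) :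
    \det (\matrix_(i, j) (g (tnth l j) * (p i).[tnth l j])) *
    \det (\matrix_(i < n, j < n) (p i).[tnth l j]) =
    gammas * ((\prod_(i < n) g (tnth l i)) * vandermonde_sqr l).
  have -> : \matrix_(i, j) (g (tnth l j) * (p i).[tnth l j]) =
      (\matrix_(i < n, j < n) (p i).[tnth l j]) *m
      diag_mx (\row_j g (tnth l j)).
    by apply/matrixP => i j; rewrite mul_mx_diag !mxE mulrC.
  rewrite det_mulmx det_diag mulrAC -expr2 det_horner_sqr; last by case: op.
  rewrite mulrAC -mulrA; congr (_ * (_ * _)).
  by apply: eq_bigr => i _; rewrite mxE.
have vE (l : n.-tuple (measurableTypeR R)) :
    (\prod_(i < n) g (tnth l i)) * vandermonde_sqr l = gammas^-1 *
    (\det (\matrix_(i, j) (g (tnth l j) * (p i).[tnth l j])) *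
     \det (\matrix_(i < n, j < n) (p i).[tnth l j])).
  by rewrite detE mulrA mulVf ?mul1r// gt_eqF.
split.
  under eq_fun do rewrite vE.
  exact: (integrableZl _ _ int_l).
by under eq_Rintegral do rewrite vE; rewrite RintegralZl// intE.
Qed.

Lemma gram1 : gram (cst 1) = 1%:M.
Proof.
apply/matrixP => i j; rewrite !mxE.
under eq_Rintegral do rewrite /= mul1r.
by case: op => _ _ ->.
Qed.

(** Quotient of Heine's formula for [g] by the one for the constant 1, whose Gram matrix is the
    identity. The common factor [z] is the normalizing constant [Z_n]. *)
Lemma integral_OPE_prod (g : measurableTypeR R -> R) C :
    measurable_fun [set: measurableTypeR R] g -> (forall x, 0 <= g x <= C) ->
  (\int[OPE mu n]_l (\prod_(i < n) g (tnth l i))%:E = (\det (gram g))%:E)%E.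
Proof.
move=> mg gC.
have g1 x : `|g x| <= C by have /andP[? ?] := gC x; rewrite ger0_norm.
have [ig hg] := heine mg g1.
have c1 (x : measurableTypeR R) : `|cst (1 : R) x| <= 1 by rewrite normr1.
have [i1 h1] := heine (measurable_cst _) c1.
pose z := gammas^-1 * n`!%:R.
have z_gt0 : 0 < z by rewrite mulr_gt0 ?invr_gt0// ltr0n fact_gt0.
have RE (h : n.-tuple (measurableTypeR R) -> R) :
    (mpower mu n).-integrable setT (EFin \o h) ->
    (\int[mpower mu n]_l (h l)%:E = (\int[mpower mu n]_l h l)%:E)%E.
  by move=> ih; rewrite fineK//; exact: integrable_fin_num ih.
rewrite (@ge0_integral_mnormalize _ _ _ _ _ z)//.
- rewrite ge0_integral_mdensity//.
  + under eq_integral do rewrite -EFinM.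
    rewrite RE// hg -EFinM; congr EFin.
    by rewrite [X in _ * X]mulrA mulKf// gt_eqF.
  + by apply/measurable_EFinP; exact: (@measurable_prod_tnth _ _ _ n (fun=> g)).
  + by move=> l; rewrite lee_fin prodr_ge0// => i _; have /andP[] := gC (tnth l i).
- rewrite /= /mdensity.
  transitivity (\int[mpower mu n]_l
      ((\prod_(i < n) cst 1 (tnth l i)) * vandermonde_sqr l)%:E)%E.
    by apply: eq_integral => l _; rewrite big1_eq mul1r.
  by rewrite RE// h1 gram1 det1 mulr1.
- by apply/measurable_EFinP; exact: (@measurable_prod_tnth _ _ _ n (fun=> g)).
- by move=> l; rewrite lee_fin prodr_ge0// => i _; have /andP[] := gC (tnth l i).
Qed.

Lemma gram_form (g : measurableTypeR R -> R) C (v : 'rV[R]_n) :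
    measurable_fun [set: measurableTypeR R] g -> (forall x, `|g x| <= C) ->
  (v *m gram g *m v^T) 0 0 =
  \int[mu]_x (g x * (\sum_(i < n) v 0 i *: p i).[x] ^+ 2).
Proof.
move=> mg gC; rewrite mxE.
have int_g i j : mu.-integrable [set: measurableTypeR R]
    (EFin \o (fun x => g x * (p i).[x] * (p j).[x])).
  rewrite /comp; under eq_fun do rewrite -mulrA -hornerM.
  exact: integrable_bounded_horner.
transitivity (\sum_(j < n) \sum_(i < n) \int[mu]_x
    ((v 0 i * v 0 j) * (g x * (p i).[x] * (p j).[x]))).
  apply: eq_bigr => j _; rewrite !mxE big_distrl/=; apply: eq_bigr => i _.
  by rewrite RintegralZl// !mxE mulrAC.
under eq_bigr => j _.
  rewrite -Rintegral_sum => [|i]; last exact: (integrableZl _ _ (int_g _ _)).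
  over.
rewrite -Rintegral_sum => [|j]; last first.
  by apply: integrable_Rsum => i; exact: (integrableZl _ _ (int_g _ _)).
apply: eq_Rintegral => x _; rewrite horner_sum expr2 big_distrl/= big_distrr/=.
rewrite exchange_big/=; apply: eq_bigr => i _.
rewrite big_distrr/= big_distrr/=; apply: eq_bigr => j _.
by rewrite !hornerZ; ring.
Qed.

(** Hadamard's inequality applies because the quadratic form of [gram g] at [v] is at least [a]
    times the squared norm of [v], hence positive for nonzero [v]. *)
Lemma det_gram_le (g : measurableTypeR R -> R) a C :
    measurable_fun [set: measurableTypeR R] g -> 0 < a ->
    (forall x, a <= g x <= C) ->
  \det (gram g) <= \prod_(i < n) gram g i i.
Proof.
move=> mg a0 aC.
have gC x : `|g x| <= C.
  have /andP[ag gC] := aC x; rewrite ger0_norm//.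
  exact: le_trans (ltW a0) ag.
apply: det_le_prod_diag.
  apply/matrixP => i j; rewrite !mxE; apply: eq_Rintegral => x _.
  by rewrite mulrAC.
move=> v v0; rewrite (gram_form _ mg gC).
pose q := \sum_(i < n) v 0 i *: p i.
have int1 : mu.-integrable [set: measurableTypeR R] (EFin \o (fun x => q.[x] ^+ 2)).
  rewrite /comp; under eq_fun do rewrite -horner_exp.
  exact: integrable_horner.
(* Parseval's identity, read off from the quadratic form for the weight 1. *)
have qv : \int[mu]_x (q.[x] ^+ 2) = \sum_(i < n) v 0 i ^+ 2.
  have c1 (x : measurableTypeR R) : `|cst (1 : R) x| <= 1 by rewrite normr1.
  have := gram_form v (measurable_cst _) c1.
  rewrite gram1 mulmx1 mxE => h; transitivity (\sum_(j < n) v 0 j * v^T j 0).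
    by rewrite h; apply: eq_Rintegral => x _; rewrite mul1r.
  by apply: eq_bigr => i _; rewrite mxE expr2.
have qv_gt0 : 0 < \int[mu]_x (q.[x] ^+ 2).
  rewrite qv lt_neqAle sumr_ge0 ?andbT => [|i _]; last exact: sqr_ge0.
  rewrite eq_sym psumr_neq0 => [|i _]; last exact: sqr_ge0.
  have /rV0Pn[i vi0] := v0.
  apply/hasP; exists i; first by rewrite mem_index_enum.
  by rewrite /= lt_neqAle sqr_ge0 eq_sym sqrf_eq0 vi0.
apply: (@lt_le_trans _ _ (\int[mu]_x (a * q.[x] ^+ 2))).
  by rewrite RintegralZl// mulr_gt0.
apply: le_Rintegral => //.
- exact: (integrableZl _ _ int1).
- rewrite /comp; under eq_fun do rewrite -horner_exp.
  exact: integrable_bounded_horner.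
- by move=> x _; rewrite ler_wpM2r ?sqr_ge0//; have /andP[] := aC x.
Qed.

End heine.

(** * Laplace transform and mean of a linear statistic *)

(** If [y] were nonzero, [t = s * y] with [s > 0] small would make the left side exceed 1 by
    [s * y ^+ 2], and the right side only by a term of order [s ^+ 2]. *)
Lemma eq0_of_le_expR_sqr (R : realType) (y b M : R) : 0 <= b -> 0 <= M ->
    (forall t, `|t| * M <= 2^-1 -> 1 + t * y <= expR (b * t ^+ 2)) ->
  y = 0.
Proof.
move=> b0 M0 H; apply/eqP; apply/negPn/negP => y0.
have yy : 0 < y ^+ 2 by rewrite lt_neqAle sqr_ge0 eq_sym sqrf_eq0 y0.
(* With [s = D^-1], each summand of [D] gives one smallness condition: [s <= 1/2], [s |y| M <= 1/2],
   [s b <= 1/4] and [s b y^2 <= 1/2]. *)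
pose D := 2 + 2 * (`|y| * M) + 4 * b + 2 * (b * y ^+ 2).
have yM0 : 0 <= `|y| * M by rewrite mulr_ge0.
have byy0 : 0 <= b * y ^+ 2 by rewrite mulr_ge0 ?sqr_ge0.
have D0 : 0 < D by rewrite /D; lra.
pose s := D^-1.
have s0 : 0 < s by rewrite /s invr_gt0.
have sD : s * D = 1 by rewrite /s mulVf// gt_eqF.
have syM : 0 <= s * (`|y| * M) by rewrite mulr_ge0// ltW.
have sb : 0 <= s * b by rewrite mulr_ge0// ltW.
have sby : 0 <= s * (b * y ^+ 2) by rewrite mulr_ge0// ltW.
move: sD; rewrite /D !mulrDr => sD.
have s1 : s <= 2^-1 by lra.
have := H (s * y); rewrite normrM (ger0_norm (ltW s0)) -mulrA => /(_ ltac:(lra)).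
set k := b * (s * y) ^+ 2.
have kE : k = s * (s * (b * y ^+ 2)) by rewrite /k; ring.
have k0 : 0 <= k by rewrite kE mulr_ge0// ltW.
have k1 : k <= 2^-1.
  rewrite kE; have : s * (s * (b * y ^+ 2)) <= 1 * (s * (b * y ^+ 2)).
    by apply: ler_wpM2r => //; lra.
  lra.
have : expR k <= 1 + k + 2 * k ^+ 2.
  by apply: expR_le_quadratic; rewrite ger0_norm.
have : k ^+ 2 <= 2^-1 * k by rewrite expr2 ler_wpM2r.
have : k <= 4^-1 * (s * y ^+ 2).
  have -> : k = (s * b) * (s * y ^+ 2) by rewrite /k; ring.
  by apply: ler_wpM2r; [rewrite mulr_ge0 ?sqr_ge0// ltW|lra].
have : 0 < s * y ^+ 2 by rewrite mulr_gt0.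
(* Altogether [1 + s y^2 <= expR k <= 1 + 2 k <= 1 + s y^2 / 2], a contradiction. *)
rewrite expr2 (mulrA s); lra.
Qed.

Section linear_statistic.
Context (R : realType) (mu : probability (measurableTypeR R) R).
Context (p : nat -> {poly R}) (n : nat).
Hypotheses (mu_moments : finite_moments mu) (op : orthonormal_upto mu p n).

(* The integral of [f x * K_n(x, x)] against [mu]. *)
Definition CD_trace (f : measurableTypeR R -> R) :=
  \sum_(j < n) \int[mu]_x (f x * ((p j).[x] * (p j).[x])).

Context (f : measurableTypeR R -> R) (M : R).
Hypotheses (mf : measurable_fun [set: measurableTypeR R] f)
  (fM : forall x, `|f x| <= M).

Lemma CD_traceN : CD_trace (\- f) = - CD_trace f.
Proof.
rewrite /CD_trace -sumrN; apply: eq_bigr => j _.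
rewrite -mulN1r -RintegralZl//.
  by apply: eq_Rintegral => x _; rewrite /= mulN1r mulNr.
rewrite /comp; under eq_fun do rewrite -hornerM.
exact: integrable_bounded_horner mf fM.
Qed.

Lemma measurable_linear_statistic :
  measurable_fun [set: n.-tuple (measurableTypeR R)] (@linear_statistic R f n).
Proof.
apply: measurable_sum => i; apply: measurableT_comp => //.
exact: measurable_tnth.
Qed.

Let M_ge0 : 0 <= M. Proof. exact: le_trans (normr_ge0 _) (fM 0). Qed.

(* Hadamard's inequality bounds the Laplace transform by the one of independent
   points with laws [p j ^+ 2 dmu]. *)
Lemma OPE_laplace t : `|t| * M <= 2^-1 ->
  (\int[OPE mu n]_l (expR (t * linear_statistic f l))%:E <=
   (expR (t * CD_trace f + 2 * n%:R * M ^+ 2 * t ^+ 2))%:E)%E.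
Proof.
move=> tM; pose g x := expR (t * f x).
have tf x : `|t * f x| <= 2^-1.
  by rewrite normrM (le_trans _ tM)// ler_wpM2l.
have mg : measurable_fun [set: measurableTypeR R] g.
  apply: measurableT_comp; first exact: measurable_expR.
  exact: measurable_funM.
have gC x : expR (- 2^-1) <= g x <= expR 2^-1.
  by rewrite !ler_expR -ler_norml.
have gC0 x : 0 <= g x <= expR 2^-1.
  by rewrite expR_ge0; have /andP[] := gC x.
have gn x : `|g x| <= expR 2^-1.
  by have /andP[? ?] := gC0 x; rewrite ger0_norm.
under eq_integral => l _.
  rewrite /linear_statistic big_distrr/= expR_sum; over.
rewrite (integral_OPE_prod mu_moments op mg gC0) lee_fin.
apply: le_trans (det_gram_le mu_moments op mg (expR_gt0 _) gC) _.
(* The exponent is split over [j], so that each diagonal entry faces one exponential factor. *)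
have -> : t * CD_trace f + 2 * n%:R * M ^+ 2 * t ^+ 2 =
    \sum_(j < n) (t * (\int[mu]_x (f x * ((p j).[x] * (p j).[x]))) +
                  2 * M ^+ 2 * t ^+ 2).
  by rewrite big_split/= -big_distrr/= sumr_const card_ord -[_ *+ n]mulr_natl /CD_trace; ring.
rewrite expR_sum; apply: ler_prod => j _; rewrite mxE.
have pp_ge0 x : 0 <= (p j).[x] * (p j).[x] by rewrite -expr2 sqr_ge0.
have int_pp (h : measurableTypeR R -> R) C : measurable_fun setT h ->
    (forall x, `|h x| <= C) -> mu.-integrable [set: measurableTypeR R]
      (EFin \o (fun x => h x * ((p j).[x] * (p j).[x]))).
  move=> mh hC; rewrite /comp; under eq_fun do rewrite -hornerM.
  exact: integrable_bounded_horner mh hC.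
have int1 : mu.-integrable [set: measurableTypeR R]
    (EFin \o (fun x => (p j).[x] * (p j).[x])).
  rewrite /comp; under eq_fun do rewrite -hornerM.
  exact: integrable_horner.
apply/andP; split.
  by apply: Rintegral_ge0 => x _; rewrite -mulrA mulr_ge0// expR_ge0.
(* It suffices to bound the entry by 1 plus the exponent. This follows by integrating the quadratic
   bound on [expR (t * f x)] against [p j ^+ 2 dmu], which has mass 1. *)
apply: le_trans (expR_ge1Dx _).
have -> : 1 + (t * \int[mu]_x (f x * ((p j).[x] * (p j).[x])) + 2 * M ^+ 2 * t ^+ 2) =
    \int[mu]_x ((1 + 2 * M ^+ 2 * t ^+ 2) * ((p j).[x] * (p j).[x]) +
                t * (f x * ((p j).[x] * (p j).[x]))).
  rewrite RintegralD//; last 2 first.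
  - exact: (integrableZl _ _ int1).
  - exact: (integrableZl _ _ (int_pp _ _ mf fM)).
  rewrite !RintegralZl//; last exact: int_pp fM.
  by case: op => _ _ -> //; rewrite eqxx mulr1; ring.
apply: le_Rintegral => //.
- rewrite /comp; under eq_fun do rewrite -mulrA.
  exact: int_pp gn.
- rewrite /comp; under eq_fun do rewrite EFinD.
  apply: integrableD => //; first exact: (integrableZl _ _ int1).
  exact: (integrableZl _ _ (int_pp _ _ mf fM)).
- move=> x _; rewrite -mulrA [X in _ <= _ + X]mulrA -mulrDl ler_wpM2r//.
  apply: le_trans (expR_le_quadratic (tf x)) _.
  have : (t * f x) ^+ 2 <= t ^+ 2 * M ^+ 2.
    rewrite exprMn ler_wpM2l ?sqr_ge0//.
    by rewrite -(real_normK (num_real (f x))) lerXn2r ?nnegrE.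
  by nra.
Qed.

Lemma integrable_linear_statistic : (OPE mu n).-integrable
  [set: n.-tuple (measurableTypeR R)] (EFin \o @linear_statistic R f n).
Proof.
apply: measurable_bounded_integrable => //.
- by rewrite -ge0_fin_numE// fin_num_measure.
- exact: measurable_linear_statistic.
- exists (n%:R * M); split; first exact: num_real.
  move=> C /ltW nMC l _ /=; apply: le_trans nMC.
  apply: (le_trans (ler_norm_sum _ _ _)).
  rewrite mulr_natl -[n in X in _ <= X]card_ord -sumr_const.
  by apply: ler_sum => i _.
Qed.

(** With [y] the mean minus [CD_trace f], [1 + t * y] is at most the Laplace transform of the
    statistic centred at [CD_trace f], hence at most [expR (2 n M^2 t^2)] for all small [t] of
    either sign. This leaves only [y = 0]. *)
Lemma OPE_expectation :
  ('E_(OPE mu n)[@linear_statistic R f n] = (CD_trace f)%:E)%E.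
Proof.
have int_l := integrable_linear_statistic.
rewrite unlock.
have EE : (\int[OPE mu n]_l (linear_statistic f l)%:E)%E =
    (\int[OPE mu n]_l (linear_statistic f l))%:E.
  by rewrite fineK//; exact: integrable_fin_num int_l.
rewrite EE; congr EFin; apply/eqP; rewrite -subr_eq0; apply/eqP.
apply: (@eq0_of_le_expR_sqr _ _ (2 * n%:R * M ^+ 2) M) => //.
  by rewrite mulr_ge0 ?sqr_ge0// mulr_ge0.
move=> t tM.
rewrite -lee_fin.
have -> : (2 * n%:R * M ^+ 2 * t ^+ 2 = (- (t * CD_trace f)) +
   (t * CD_trace f + 2 * n%:R * M ^+ 2 * t ^+ 2))%R by ring.
rewrite expRD EFinM.
apply: le_trans (lee_wpmul2l _ (OPE_laplace tM)); last by rewrite lee_fin expR_ge0.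
have mexp : measurable_fun [set: n.-tuple (measurableTypeR R)]
    (fun l => expR (t * linear_statistic f l)).
  apply: measurableT_comp; first exact: measurable_expR.
  by apply: measurable_funM => //; exact: measurable_linear_statistic.
have int_exp : (OPE mu n).-integrable [set: n.-tuple (measurableTypeR R)]
    (EFin \o (fun l => expR (t * linear_statistic f l))).
  apply/integrableP; split; first exact/measurable_EFinP.
  under eq_integral do rewrite /= ger0_norm ?expR_ge0//.
  by apply: le_lt_trans (OPE_laplace tM) _; rewrite ltry.
rewrite -integralZl//.
have int_c (c : R) : (OPE mu n).-integrable [set: n.-tuple (measurableTypeR R)] (EFin \o cst c).
  exact: finite_measure_integrable_cst.
have int_aff : (OPE mu n).-integrable [set: n.-tuple (measurableTypeR R)]
    (EFin \o (fun l => (1 - t * CD_trace f) + t * linear_statistic f l)).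
  rewrite /comp; under eq_fun do rewrite EFinD.
  by apply: integrableD => //; [exact: int_c|exact: (integrableZl _ t int_l)].
have -> : 1 + t * (\int[OPE mu n]_l linear_statistic f l - CD_trace f) =
    \int[OPE mu n]_l ((1 - t * CD_trace f) + t * linear_statistic f l).
  rewrite RintegralD//; [|exact: int_c|exact: (integrableZl _ t int_l)].
  rewrite RintegralZl// Rintegral_cst//.
  rewrite [X in _ * fine X](_ : _ = 1%E); last exact: probability_setT.
  by rewrite mulr1; ring.
rewrite /Rintegral fineK; last exact: integrable_fin_num int_aff.
apply: le_integral => //; first exact: integrableZl.
move=> l _; rewrite -EFinM -expRD lee_fin.
by apply: le_trans (expR_ge1Dx _); rewrite addrA.
Qed.

End linear_statistic.

(** * Deviation inequality by Chernoff's bound *)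

Lemma measurable_superlevel d (T : measurableType d) (R : realType) (h : T -> R)
    (a : R) : measurable_fun [set: T] h -> measurable [set x | a <= h x].
Proof.
move=> mh; rewrite -[X in measurable X]setTI.
have -> : [set x | a <= h x] = h @^-1` [set` `[a, +oo[].
  by apply/seteqP; split => x /=; rewrite in_itv/= andbT.
exact: mh.
Qed.

Section deviation.
Context (R : realType) (mu : probability (measurableTypeR R) R).
Context (p : nat -> {poly R}) (n : nat).
Hypotheses (mu_moments : finite_moments mu) (op : orthonormal_upto mu p n).

(** The minimum in the theorem for [A = 1], with a bound [M] on [|f|] in place of the supremum
    norm. *)
Definition deviation_rate (M eps : R) :=
  Num.min (eps / (8 * M ^+ 2)) (1 / (6 * M)).

Lemma deviation_rate_gt0 (M eps : R) : 0 < M -> 0 < eps -> 0 < deviation_rate M eps.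
Proof.
move=> M0 e0; rewrite /deviation_rate lt_min.
by apply/andP; split; rewrite divr_gt0// mulr_gt0// exprn_gt0.
Qed.

Lemma OPE_upper_tail (f : measurableTypeR R -> R) (M eps : R) :
    measurable_fun [set: measurableTypeR R] f -> (forall x, `|f x| <= M) ->
    0 < M -> 0 < eps ->
  (OPE mu n [set l | (CD_trace mu p n f + n%:R * eps <= linear_statistic f l)%R]
   <= (expR (- (n%:R * eps * deviation_rate M eps)))%:E)%E.
Proof.
move=> mf fM M0 e0.
(* The exponent per point, [t eps - 2 M^2 t^2], is maximal at [t = eps / (4 M^2)], with value
   [eps^2 / (8 M^2)]; this [t] is admissible for [eps <= 2 M]. *)
have [t [t0 tM tr]] : exists t, [/\ 0 < t, t * M <= 2^-1 &
    eps * deviation_rate M eps <= t * eps - 2 * M ^+ 2 * t ^+ 2].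
  have MM : 0 < M ^+ 2 by rewrite exprn_gt0.
  have M_neq0 : M != 0 by rewrite gt_eqF.
  have [eM|Me] := leP eps (2 * M).
    exists (eps / (4 * M ^+ 2)); split.
    - by rewrite divr_gt0// mulr_gt0.
    - rewrite [leLHS](_ : _ = eps / (4 * M)); last by field.
      by rewrite ler_pdivrMr ?mulr_gt0//; lra.
    - rewrite [leRHS](_ : _ = eps * (eps / (8 * M ^+ 2))); last by field.
      by rewrite ler_pM2l// ge_min lexx.
  (* Beyond that range the end point [t = 1 / (2 M)] gives [eps / (2 M) - 1/2], which is at least
     [eps / (6 M)] as soon as [eps >= 3 M / 2]. *)
  exists (2 * M)^-1; split.
  - by rewrite invr_gt0 mulr_gt0.
  - by rewrite invfM -mulrA mulVf// mulr1.
  - apply: (@le_trans _ _ (eps * (1 / (6 * M)))).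
      by rewrite ler_pM2l// ge_min lexx orbT.
    rewrite -subr_ge0 [leRHS](_ : _ = (eps * 2 - 3 * M) / (6 * M)); last by field.
    by rewrite divr_ge0//; [lra|rewrite mulr_ge0// ltW].
have mX := @measurable_linear_statistic _ n f mf.
pose X : {RV OPE mu n >-> R} :=
  HB.pack (@linear_statistic R f n) (isMeasurableFun.Build _ _ _ _ _ mX).
apply: le_trans (chernoff X (CD_trace mu p n f + n%:R * eps) t0) _.
rewrite /mmt_gen_fun unlock.
have -> : (\int[OPE mu n]_w ((expR \o t \o* X) w)%:E =
    \int[OPE mu n]_l (expR (t * linear_statistic f l))%:E)%E.
  by apply: eq_integral => l _; rewrite /= mulrC.
have tM' : `|t| * M <= 2^-1 by rewrite gtr0_norm.
apply: le_trans (lee_wpmul2r _ (OPE_laplace mu_moments op mf fM tM')) _.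
  by rewrite lee_fin expR_ge0.
rewrite -EFinM lee_fin -expRD ler_expR.
have : n%:R * (eps * deviation_rate M eps) <=
  n%:R * (t * eps - 2 * M ^+ 2 * t ^+ 2) by rewrite ler_wpM2l.
lra.
Qed.

(** The event is covered by an upper tail of [f] and one of [- f], with the same bound; hence the
    factor 2. *)
Lemma OPE_deviation (f : measurableTypeR R -> R) (M eps : R) :
    measurable_fun [set: measurableTypeR R] f -> (forall x, `|f x| <= M) ->
    0 < M -> 0 < eps -> (0 < n)%N ->
  (OPE mu n [set l | (eps <= `| n%:R^-1 * linear_statistic f l
      - n%:R^-1 * CD_trace mu p n f |)%R]
   <= (2 * expR (- (n%:R * eps * deviation_rate M eps)))%:E)%E.
Proof.
move=> mf fM M0 e0 n0; have n_gt0 : 0 < n%:R :> R by rewrite ltr0n.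
have mtail (g : measurableTypeR R -> R) a : measurable_fun setT g ->
    measurable [set l | (a <= @linear_statistic R g n l)%R].
  by move=> mg; apply: measurable_superlevel; exact: measurable_linear_statistic.
pose U (g : measurableTypeR R -> R) := [set l : n.-tuple (measurableTypeR R) |
  (CD_trace mu p n g + n%:R * eps <= linear_statistic g l)%R].
have mNf : measurable_fun [set: measurableTypeR R] (\- f) by exact: measurable_funN.
have NfM x : `|(\- f) x| <= M by rewrite normrN.
have sub : [set l | (eps <= `| n%:R^-1 * linear_statistic f l
      - n%:R^-1 * CD_trace mu p n f |)%R] `<=` U f `|` U (\- f).
  move=> l /=; rewrite -mulrBr normrM gtr0_norm ?invr_gt0//.
  rewrite mulrC ler_pdivlMr// ler_normr => /orP[h|h]; [left|right]; rewrite /U/=.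
    lra.
  rewrite (CD_traceN _ _ mu_moments mf fM).
  have -> : linear_statistic (\- f) l = - linear_statistic f l.
    by rewrite /linear_statistic -sumrN.
  lra.
apply: (@le_trans _ _ (OPE mu n (U f `|` U (\- f)))).
  apply: le_measure => //; rewrite inE.
    apply: measurable_superlevel; apply: measurableT_comp => //.
    apply: measurable_funB => //; apply: measurable_funM => //.
    exact: measurable_linear_statistic.
  by apply: measurableU; exact: mtail.
apply: le_trans (measureU2 _ _ _) _; [exact: mtail|exact: mtail|].
rewrite mulrDl mul1r EFinD; apply: leeD.
  exact: OPE_upper_tail.
exact: OPE_upper_tail.
Qed.

End deviation.

(** * Weak limits, Borel-Cantelli and the two conclusions *)

Lemma le_sup_norm (R : realType) (f : R -> R) x :
  bounded_fun f -> `|f x| <= sup_norm f.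
Proof.
move=> [C [_ fC]]; apply: ub_le_sup; last by exists x.
(* [bounded_fun] provides as bounds the numbers strictly above [C]. *)
exists (C + 1) => _ [y _ <-]; apply: fC => //; by rewrite ltrDl.
Qed.

Lemma orthonormal_polynomials_upto (R : realType)
    (mu : probability (measurableTypeR R) R) p n :
  orthonormal_polynomials mu p -> orthonormal_upto mu p n.
Proof.
by move=> [sp lp op]; split=> [j _|j _|i j _ _]//; rewrite /Rintegral op.
Qed.

(** Identifies the centring of the deviation bound with the integral that weak convergence
    controls. *)
Lemma integral_CD_measure (R : realType)
    (mu : probability (measurableTypeR R) R) p n (f : measurableTypeR R -> R) M :
    finite_moments mu -> measurable_fun [set: measurableTypeR R] f ->
    (forall x, `|f x| <= M) ->
  (\int[CD_measure mu p n]_x (f x)%:E = (n%:R^-1 * CD_trace mu p n f)%:E)%E.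
Proof.
move=> mu_moments mf fM.
rewrite /CD_measure integral_mdensity; last exact/measurable_EFinP.
have int_j (j : 'I_n) : mu.-integrable [set: measurableTypeR R]
    (EFin \o (fun x => f x * ((p j).[x] * (p j).[x]))).
  rewrite /comp; under eq_fun do rewrite -hornerM.
  exact: integrable_bounded_horner mf fM.
have fE x : f x * CD_density p n x =
    n%:R^-1 * \sum_(j < n) f x * ((p j).[x] * (p j).[x]).
  by rewrite /CD_density /CD_kernel mulrCA big_distrr.
have int_sum : mu.-integrable [set: measurableTypeR R]
    (EFin \o (fun x => \sum_(j < n) f x * ((p j).[x] * (p j).[x]))).
  exact: integrable_Rsum.
under eq_integral do rewrite -EFinM fE.
rewrite -[LHS]fineK; last first.
  exact: (integrable_fin_num measurableT (integrableZl measurableT _ int_sum)).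
congr EFin.
rewrite -[LHS]/(\int[mu]_x (n%:R^-1 * \sum_(j < n) f x * ((p j).[x] * (p j).[x]))).
by rewrite RintegralZl// Rintegral_sum.
Qed.

(** Borel-Cantelli for each threshold [1 / (k + 1)], the probabilities being dominated by a
    geometric series. The union over [k] of the null upper limits is negligible, and off it [Y w n]
    is eventually below every threshold. *)
Lemma ae_cvg_summable_deviation d (T : measurableType d) (R : realType)
    (P : probability T R) (Y : T -> nat -> R) (c : R -> R) :
    (forall eps, 0 < eps -> 0 < c eps) ->
    (forall n eps, 0 < eps -> (0 < n)%N ->
      measurable [set w | eps <= `|Y w n|] /\
      (P [set w | (eps <= `|Y w n|)%R] <= (2 * expR (- (n%:R * c eps)))%:E)%E) ->
  {ae P, forall w, Y w n @[n --> \oo] --> (0 : R)}.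
Proof.
move=> c0 PY.
(* The bound is assumed for [n > 0], so index 0 gets the empty event; the ranks below start at
   [N.+1] to avoid it. *)
pose F k n := if n is 0 then set0 else [set w | k.+1%:R^-1 <= `|Y w n|].
have k0 k : 0 < k.+1%:R^-1 :> R by rewrite invr_gt0.
have mF k n : measurable (F k n).
  by case: n => //= n; have [] := PY n.+1 _ (k0 k) isT.
have limF k : P (lim_sup_set (F k)) = 0.
  apply: lim_sup_set_cvg0 => //.
  pose r := expR (- c k.+1%:R^-1).
  have r1 : `|r| < 1.
    by rewrite ger0_norm ?expR_ge0// expR_lt1 oppr_lt0 c0.
  have PF n : (P (F k n) <= (geometric 2 r n)%:E)%E.
    case: n => [|n] /=; first by rewrite measure0 lee_fin mulr_ge0// exprn_ge0// expR_ge0.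
    have [_ /le_trans] := PY n.+1 _ (k0 k) isT; apply.
    by rewrite lee_fin /r -expRM_natl mulrN.
  apply: (@le_lt_trans _ _ (\sum_(n <oo) (geometric 2 r n)%:E)%E).
    by apply: lee_nneseries => *; [exact: measure_ge0|exact: PF].
  have -> : (\sum_(n <oo) (geometric 2 r n)%:E)%E =
      (limn (series (geometric 2 r)))%:E.
    rewrite -EFin_lim; last exact: is_cvg_geometric_series.
    by congr (limn _); apply/funext => n /=; rewrite sumEFin.
  by rewrite ltry.
have [A [mA A0 FA]] : P.-negligible (\bigcup_k lim_sup_set (F k)).
  apply: negligible_bigcup => k; apply/negligibleP; last exact: limF.
  apply: bigcap_measurable => // n _.
  exact: bigcup_measurable.
exists A; split => // w /= Yw; apply: FA; apply: contrapT => nF; apply: Yw.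
apply/cvgrPdist_lt => e e0.
have [k _ /(_ k (leqnn k)) /= ke] := near_infty_natSinv_lt (PosNum e0).
have : ~ lim_sup_set (F k) w by move=> Fkw; apply: nF; exists k.
move=> /existsNP[N /not_implyP[_ FN]].
exists N.+1 => // -[//|n] /= Nn; rewrite sub0r normrN.
apply: le_lt_trans ke; rewrite leNgt; apply/negP => /ltW h.
by apply: FN; exists n.+1 => //=; exact: ltnW.
Qed.

(* In the extended reals [0^-1 = +oo], so that the bound reads
   [2 * exp (-oo) = 0] when [f = 0]. *)
Theorem theorem1p1 (R : realType) :
  (exists A : R, 0 < A /\
    forall mu : probability (measurableTypeR R) R,
    finite_moments mu -> infinite_set (msupport mu) ->
    forall f : R -> R,
    measurable_fun [set: measurableTypeR R] f -> bounded_fun f ->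
    forall eps : R, 0 < eps ->
    forall n : nat, (0 < n)%N ->
    (OPE mu n [set l | (eps <=
        `| n%:R^-1 * linear_statistic f l
           - n%:R^-1 * fine ('E_(OPE mu n)[linear_statistic f (n := n)])%E |)%R]
     <= 2%:E * expeR (- ((n%:R * eps)%:E *
          Order.min (eps%:E / (8 * A * sup_norm f ^+ 2)%:E)
                    (1 / (6 * sup_norm f)%:E))))%E)
  /\
  (forall (mu : nat -> probability (measurableTypeR R) R)
     (p : nat -> nat -> {poly R})
     (nu : {finite_measure set (measurableTypeR R) -> \bar R}),
   (forall n, (0 < n)%N -> finite_moments (mu n)) ->
   (forall n, (0 < n)%N -> infinite_set (msupport (mu n))) ->
   (forall n, (0 < n)%N -> orthonormal_polynomials (mu n) (p n)) ->
   weakly_converges (fun n => CD_measure (mu n) (p n) n) nu ->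
   forall f : R -> R, continuous f -> bounded_fun f ->
   forall (d : measure_display) (Omega : measurableType d)
     (P : probability Omega R)
     (lambda : forall n : nat, {RV P >-> n.-tuple (measurableTypeR R)}),
   (forall n, (0 < n)%N ->
      forall A, measurable A -> distribution P (lambda n) A = OPE (mu n) n A) ->
   {ae P, forall omega,
     n%:R^-1 * linear_statistic f (lambda n omega) @[n --> \oo]
       --> \int[nu]_x f x}).
Proof.
split.
  exists 1; split => // mu mu_moments mu_support f mf bf eps e0 n n0.
  have [p op] := orthonormal_upto_exists mu_moments mu_support n.
  have fM x : `|f x| <= sup_norm f by exact: le_sup_norm.
  rewrite (OPE_expectation mu_moments op mf fM)/=.
  (* If the norm vanishes then [f = 0] and the event is empty, as [eps > 0]; it remains that the
     bound is nonnegative. *)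
  have [M0|/eqP M0] := eqVneq (sup_norm f) 0.
    have f0 x : f x = 0 by apply/eqP; rewrite -normr_le0 -M0.
    have X0 (l : n.-tuple (measurableTypeR R)) : linear_statistic f l = 0.
      by rewrite /linear_statistic big1.
    have C0 : CD_trace mu p n f = 0.
      rewrite /CD_trace big1// => j _.
      under eq_Rintegral do rewrite f0 mul0r.
      by rewrite Rintegral_cst// mul0r.
    rewrite [X in OPE mu n X](_ : _ = set0) ?measure0.
      by rewrite mule_ge0// ?lee_fin// expeR_ge0.
    apply/seteqP; split => // l /=.
    by rewrite X0 C0 !mulr0 subrr normr0 leNgt e0.
  have M_gt0 : 0 < sup_norm f.
    rewrite lt_neqAle eq_sym; apply/andP; split; first exact/eqP.
    exact: le_trans (normr_ge0 _) (fM 0).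
  apply: le_trans (OPE_deviation mu_moments op mf fM M_gt0 e0 n0) _.
  rewrite EFinM; apply: lee_wpmul2l; first by rewrite lee_fin.
  rewrite mulr1 !inver !gt_eqF ?mulr_gt0 ?exprn_gt0//.
  rewrite -!EFinM -EFin_min /deviation_rate -EFinM.
  by rewrite lexx.
move=> mu p nu mu_moments mu_support op cvg_nu f cf bf d Omega P lambda lambdaE.
(* Adding 1 makes the bound positive even when [f = 0]; any positive bound gives summable tails. *)
pose M := sup_norm f + 1.
have M_ge0 : 0 <= sup_norm f by exact: le_trans (normr_ge0 _) (le_sup_norm 0 bf).
have M_gt0 : 0 < M by rewrite ltr_wpDl.
have fM x : `|f x| <= M by rewrite (le_trans (le_sup_norm x bf))// lerDl.
have mf : measurable_fun [set: measurableTypeR R] f.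
  exact: continuous_measurable_fun.
pose m n := n%:R^-1 * CD_trace (mu n) (p n) n f.
have cvg_m : m n @[n --> \oo] --> \int[nu]_x f x.
  have int_f : nu.-integrable [set: measurableTypeR R] (EFin \o f).
    apply: measurable_bounded_integrable => //.
    by rewrite -ge0_fin_numE// fin_num_measure.
  have := cvg_nu f cf bf.
  rewrite -[X in _ --> X]fineK; last exact: integrable_fin_num int_f.
  move=> /fine_cvg; apply: cvg_trans; apply: near_eq_cvg.
  exists 1%N => // n /= n0.
  by rewrite (integral_CD_measure _ _ (mu_moments n n0) mf fM).
have : {ae P, forall w,
    n%:R^-1 * linear_statistic f (lambda n w) - m n @[n --> \oo] --> (0 : R)}.
  apply: (@ae_cvg_summable_deviation _ _ _ P _
    (fun eps => eps * deviation_rate M eps)) => [eps e0|n eps e0 n0].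
    by rewrite mulr_gt0// deviation_rate_gt0.
  have opn := orthonormal_polynomials_upto n (op n n0).
  have mS : measurable [set l | eps <= `|n%:R^-1 * @linear_statistic R f n l - m n|].
    apply: measurable_superlevel; apply: measurableT_comp => //.
    apply: measurable_funB => //; apply: measurable_funM => //.
    exact: measurable_linear_statistic.
  split.
    have := measurable_funP (lambda n) measurableT _ mS.
    by rewrite setTI.
  have := OPE_deviation (mu_moments n n0) opn mf fM M_gt0 e0 n0.
  (* The bound is carried to [P] through the law of [lambda n] alone, whatever the coupling. *)
  by rewrite -lambdaE// mulrA.
apply: filterS => w h.
have := cvgD h cvg_m; rewrite add0r.
rewrite [X in X @ _ --> _](_ : _ =
  fun n => n%:R^-1 * linear_statistic f (lambda n w)); first exact.
by apply/funext => n /=; rewrite fctE subrK.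
Qed.
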